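(* Let $n\ge 1$, let $\sigma\in S_n$, and let $\lambda=(\lambda_1\ge\lambda_2\ge\dots\ge\lambda_n\ge 0)$ be a partition with $n$ parts (zeros allowed). Then \[ \mathrm{E}^\sigma_\lambda(x_1,\dots,x_n;1,t)=\mathrm{E}^\sigma_\lambda(x_1,\dots,x_n;1,0)=e_{\lambda'}(x_1,\dots,x_n), \] where $\lambda'$ is the conjugate partition and $e_{\nu}=\prod_i e_{\nu_i}$ is the elementary symmetric polynomial.
   Context: Permuted-basement Macdonald polynomials. A weak composition $\lambda=(\lambda_1,\dots,\lambda_n)$ is a vector of non-negative integers. For $\sigma\in S_n$ in one-line notation, an augmented filling of shape $\lambda$ and basement $\sigma$ is an assignment $F$ of a positive integer to each box $(r,c)$ with $1\le r\le n$, $0\le c\le\lambda_r$ (row $r$ counted from the top, column $c$ from the left), with $F(r,0)=\sigma_r$; column $0$ is the basement, boxes with $c\ge1$ are non-basement boxes. Two boxes are attacking if they have equal entries and either lie in the same column, or lie in adjacent columns $c-1,c$ with the box in column $c$ in a row strictly below the other. $\mathrm{NAF}_\sigma(\lambda)$ is the set of augmented fillings with no attacking pair and all non-basement entries in $\{1,\dots,n\}$. A type $A$ triple consists of boxes $a=(r,c-1)$, $b=(r,c)$, $z=(r',c)$ with $c\ge1$, $r'>r$, $\lambda_r\ge\lambda_{r'}$. A type $B$ triple consists of $a=(r,c-1)$, $b=(r,c)$, $z=(r',c-1)$ with $c\ge 1$, $r'<r$, $\lambda_r>\lambda_{r'}$. Writing $A=F(a),B=F(b),C=F(z)$ and comparing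 the pairs $(A,3),(C,2),(B,1)$ lexicographically (so ties are broken with $a$ largest, then $z$, then $b$), the triple is an inversion triple if $A<C<B$, or $C<B<A$, or $B<A<C$; otherwise it is a coinversion triple. $\mathrm{coinv}(F)$ is the number of coinversion triples (of both types). For a box $u=(r,c)$: $\mathrm{leg}(u)=\lambda_r-c$, and $\mathrm{arm}(u)=\#\{r'>r:\lambda_{r'}\le\lambda_r,\ c\le\lambda_{r'}\}+\#\{r'<r:\lambda_{r'}<\lambda_r,\ c-1\le\lambda_{r'}\}$. A descent is a non-basement box $u=(r,c)$ with $F(r,c-1)<F(r,c)$; $\mathrm{maj}(F)=\sum_{u\text{ descent}}(\mathrm{leg}(u)+1)$. $\mathbf{x}^F=\prod_{u \text{ non-basement}}x_{F(u)}$. Then \[\mathrm{E}^\sigma_\lambda(\mathbf{x};q,t)=\sum_{F\in\mathrm{NAF}_\sigma(\lambda)}\mathbf{x}^F q^{\mathrm{maj}(F)}t^{\mathrm{coinv}(F)}\prod_{\substack{u=(r,c),\,c\ge1\\ F(r,c-1)\ne F(r,c)}}\frac{1-t}{1-q^{1+\mathrm{leg}(u)}t^{1+\mathrm{arm}(u)}}.\] *)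

(* Defs.v *)
From HB Require Import structures.
From mathcomp Require Import all_boot all_order all_algebra all_fingroup.
From mathcomp Require Export mpoly.

Set Implicit Arguments.
Unset Strict Implicit.
Unset Printing Implicit Defensive.

Import GRing.Theory.
Local Open Scope ring_scope.

(* Rows and entries are 0-based: the paper's row r and entry i are the elements
   r - 1 and i - 1 of 'I_n.  Every statistic only compares entries and rows, so
   the shift is harmless.  Columns keep their numbering, column 0 being the
   basement. *)

Section AugmentedDiagram.

Variables (n : nat) (la : n.-tuple nat).

(* row r has the boxes (r, 0), ..., (r, la_r) *)
Definition box : finType := {r : 'I_n & 'I_(tnth la r).+1}.

Definition row_of (u : box) : 'I_n := tag u.
Definition col_of (u : box) : nat := tagged u.

Definition basement (u : box) : bool := col_of u == 0%N.

(* (r, c - 1) when u = (r, c) is a non-basement box; u itself otherwise *)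
Definition west (u : box) : box :=
  Tagged (fun r : 'I_n => 'I_(tnth la r).+1)
    (inord (col_of u).-1 : 'I_(tnth la (row_of u)).+1).

Definition row_len (u : box) : nat := tnth la (row_of u).

Definition leg (u : box) : nat := (row_len u - col_of u)%N.

Definition arm (u : box) : nat :=
  (#|[set r : 'I_n | [&& (row_of u < r)%N, (tnth la r <= row_len u)%N
                       & (col_of u <= tnth la r)%N]]|
   + #|[set r : 'I_n | [&& (r < row_of u)%N, (tnth la r < row_len u)%N
                         & ((col_of u).-1 <= tnth la r)%N]]|)%N.

(* The boxes a = west b, b and z form a triple of type A, resp. B; since a is
   determined by b, triples are counted as pairs (b, z). *)
Definition typeA (b z : box) : bool :=
  [&& ~~ basement b, col_of z == col_of b, (row_of b < row_of z)%N
    & (row_len z <= row_len b)%N].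

Definition typeB (b z : box) : bool :=
  [&& ~~ basement b, (col_of z).+1 == col_of b, (row_of z < row_of b)%N
    & (row_len z < row_len b)%N].

Definition lexlt (p p' : nat * nat) : bool :=
  (p.1 < p'.1)%N || (p.1 == p'.1) && (p.2 < p'.2)%N.

Section Filling.

Variable F : {ffun box -> 'I_n}.

Definition attacking (u v : box) : bool :=
  (F u == F v) &&
  ((u != v) && (col_of u == col_of v)
   || (col_of v == (col_of u).+1) && (row_of u < row_of v)%N).

Definition inversion_triple (b z : box) : bool :=
  let A := (F (west b) : nat, 3%N) in
  let B := (F b : nat, 1%N) in
  let C := (F z : nat, 2%N) in
  [|| lexlt A C && lexlt C B, lexlt C B && lexlt B A
    | lexlt B A && lexlt A C].

Definition coinv : nat :=
  #|[set bz : box * box | (typeA bz.1 bz.2 || typeB bz.1 bz.2)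
                          && ~~ inversion_triple bz.1 bz.2]|.

Definition descent (u : box) : bool :=
  ~~ basement u && (F (west u) < F u)%N.

Definition maj : nat := (\sum_(u : box | descent u) (leg u).+1)%N.

End Filling.

Definition NAF (sigma : 'S_n) : {set {ffun box -> 'I_n}} :=
  [set F : {ffun box -> 'I_n} |
     [forall u : box, basement u ==> (F u == sigma (row_of u))]
     && [forall u : box, forall v : box, ~~ attacking F u v]].

(* The parameters q and t live in an arbitrary field K; for indeterminates,
   take K to be a field of rational functions. *)
Definition pbMacdonald (K : fieldType) (sigma : 'S_n) (q t : K)
    : {mpoly K[n]} :=
  \sum_(F in NAF sigma)
    (q ^+ maj F * t ^+ coinv F
     * \prod_(u : box | ~~ basement u && (F (west u) != F u))
         ((1 - t) / (1 - q ^+ (1 + leg u) * t ^+ (1 + arm u))))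
    *: \prod_(u : box | ~~ basement u) 'X_(F u).

(* the j-th part, 1 <= j <= max la, is #{i : la_i >= j} *)
Definition conj_parts : seq nat :=
  [seq #|[set r : 'I_n | (j <= tnth la r)%N]|
     | j <- iota 1 (\max_(r < n) tnth la r)].

End AugmentedDiagram.

Definition elem_sym (K : fieldType) (n : nat) (nu : seq nat) : {mpoly K[n]} :=
  \prod_(k <- nu) mesym n K k.

(* Main.v *)
Require Import Defs.
From mathcomp Require Import all_boot all_order all_algebra all_fingroup.
From mathcomp Require Import zify.

Set Implicit Arguments.
Unset Strict Implicit.
Unset Printing Implicit Defensive.

Import GRing.Theory.
Local Open Scope ring_scope.

(* Fix the set of entries of every column.  For a partition no type B triple
   exists, and every row below a box u that meets the column of u contributes a
   type A triple and one unit of arm, so at q = 1 the weight of a filling is a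
   product over boxes.  The factor of u depends on the entry a to its left and on
   the set R of entries of its column not yet used above u.  If a lies in R,
   non-attacking forces u to have entry a, with factor 1.  Otherwise u may take
   any value of R; the coinversion triples at u count the elements of R after it
   in the cyclic order starting at a, and the factors add up to
   (1 + t + ... + t^(|R| - 1)) (1 - t) / (1 - t^|R|) = 1.  Summing over boxes in
   reverse reading order, the fillings with given column sets have total weight 1,
   and summing the monomials over all families of column sets gives the product
   of elementary symmetric polynomials. *)

(** * Sums of products of sequentially local weights *)

Section SequentialSum.

Variables (K : comNzRingType) (I T : finType) (key : I -> nat).
Variable w : I -> {ffun I -> T} -> K.

Definition upd (F : {ffun I -> T}) (u : I) (x : T) : {ffun I -> T} :=
  [ffun v => if v == u then x else F v].

Hypothesis w_local : forall u (F G : {ffun I -> T}), F u = G u ->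
  (forall v, (key v < key u)%N -> F v = G v) -> w u F = w u G.
Hypothesis w_sum1 : forall u F, \sum_x w u (upd F u x) = 1.

(** Freezing the values outside [D] lets the induction take an element of least key out of [D]: its
    factor sees only its own value and frozen ones, so it leaves the inner sum, which is 1, and is
    then summed by [w_sum1]. *)
Lemma sum_prod_local_on (D : {set I}) (F0 : {ffun I -> T}) :
  \sum_(F : {ffun I -> T} | [forall v, (v \notin D) ==> (F v == F0 v)]) \prod_(u in D) w u F = 1.
Proof.
move: {2}#|D| (erefl #|D|) => k; elim: k D F0 => [|k IHk] D F0 cardD.
  rewrite (cards0_eq cardD) (big_pred1 F0) ?big_set0 // => F.
  apply/forallP/eqP => [eqF | -> v]; last by rewrite eqxx implybT.
  by apply/ffunP=> v; have:= eqF v; rewrite in_set0 => /eqP.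
have /card_gt0P [u0 Du0]: (0 < #|D|)%N by rewrite cardD.
case: (arg_minnP key Du0) => u; rewrite -[_ u]/(u \in D) => Du min_u.
have cardDu : #|D :\ u| = k by move: cardD; rewrite (cardsD1 u) Du; lia.
rewrite (partition_big (fun F : {ffun I -> T} => F u) predT) //=.
rewrite -[RHS](w_sum1 u F0); apply: eq_bigr => x _.
rewrite -[RHS]mulr1 -[X in _ = _ * X](IHk _ (upd F0 u x) cardDu) mulr_sumr.
apply: eq_big => [F | F /andP[/forallP eqF /eqP Fu]].
  apply/andP/forallP => [[/forallP eqF /eqP Fu] v | eqF].
    apply/implyP; rewrite !inE negb_and negbK ffunE.
    by case: eqP => [-> | _] /=; [rewrite Fu | move/(implyP (eqF v))].
  have:= eqF u; rewrite !inE eqxx ffunE eqxx => Fu; split=> //.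
  apply/forallP=> v; apply/implyP=> Dv.
  have:= eqF v; rewrite !inE negb_and Dv orbT ffunE.
  by case: (v =P u) => [vu | _ /eqP //]; rewrite vu Du in Dv.
rewrite (big_setD1 u Du) /=; congr (_ * _).
apply: w_local => [|v lt_vu]; first by rewrite ffunE eqxx.
rewrite ffunE; case: eqP => [-> // | _].
apply/eqP/(implyP (eqF v)); apply: contraL lt_vu => /min_u.
by rewrite -leqNgt.
Qed.

Lemma sum_prod_local (F0 : {ffun I -> T}) : \sum_F \prod_u w u F = 1.
Proof.
rewrite -[RHS](sum_prod_local_on setT F0); apply: eq_big => [F | F _].
  by apply/esym/forallP=> v; rewrite in_setT.
by apply: eq_bigl => u; rewrite in_setT.
Qed.

End SequentialSum.

(** * Coinversions and the cyclic order of entries *)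

(** When [R] is listed by increasing [pos], the exponents run down from [#|R| - 1] to 0. *)
Lemma sum_exp_rank (K : comNzRingType) (I : finType) (t : K) (pos : I -> nat)
    (R : {set I}) : {in R &, injective pos} ->
  \sum_(x in R) t ^+ #|[set z in R | (pos x < pos z)%N]| = \sum_(k < #|R|) t ^+ k.
Proof.
move: {2}#|R| (erefl #|R|) => k; elim: k R => [|k IHk] R cardR inj_pos.
  by rewrite (cards0_eq cardR) cards0 big_set0 big_ord0.
have /card_gt0P [u0 Ru0]: (0 < #|R|)%N by rewrite cardR.
case: (arg_minnP pos Ru0) => u; rewrite -[_ u]/(u \in R) => Ru min_u.
have cardRu : #|R :\ u| = k by move: cardR; rewrite (cardsD1 u) Ru; lia.
rewrite cardR big_ord_recr /= -cardRu -(IHk _ cardRu); last first.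
  by move=> x y /setD1P[_ Rx] /setD1P[_ Ry]; apply: inj_pos.
rewrite (big_setD1 u Ru) /= addrC; congr (_ + _).
  apply: eq_bigr => x /setD1P[_ Rx]; congr (_ ^+ _); apply: eq_card => z.
  rewrite !inE; case: eqP => [-> | //] /=.
  by apply/negbTE/nandP; right; rewrite -leqNgt min_u.
congr (_ ^+ _); apply: eq_card => z; rewrite !inE.
case Rz: (z \in R); rewrite ?andbF //= andbT ltn_neqAle min_u // andbT.
by congr (~~ _); apply/eqP/eqP => [/inj_pos-> // | -> //].
Qed.

(* [inversion_triple], for boxes a, b, z with entries [A], [B], [C]. *)
Definition inversion_values (A B C : nat) : bool :=
  [|| lexlt (A, 3%N) (C, 2%N) && lexlt (C, 2%N) (B, 1%N),
      lexlt (C, 2%N) (B, 1%N) && lexlt (B, 1%N) (A, 3%N)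
    | lexlt (B, 1%N) (A, 3%N) && lexlt (A, 3%N) (C, 2%N)].

(* [pos] ranks entries in the cyclic order starting just after [A]. *)
Lemma inversion_valuesP (n : nat) (A B C : 'I_n) : C != A -> C != B ->
  B != A -> let pos (x : 'I_n) := (if A < x then x - A else x + n - A)%N in
  ~~ inversion_values A B C = (pos B < pos C)%N.
Proof.
rewrite -!val_eqE /inversion_values /lexlt /=.
case: A B C => [a lt_a] [b lt_b] [c lt_c] /=.
by case: (ltngtP a b); case: (ltngtP a c); case: (ltngtP b c); lia.
Qed.

(** Both copies of [A] lie on the same side of [C], and the tie rule puts [b] before [a]: the order
    is C, b, a or b, a, C. *)
Lemma inversion_values_diag (A C : nat) : C != A -> inversion_values A A C.
Proof. by rewrite /inversion_values /lexlt /=; lia. Qed.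

Lemma sum_coinv_entries (K : comNzRingType) (n : nat) (t : K) (a : 'I_n)
    (R : {set 'I_n}) : a \notin R ->
  \sum_(x in R) t ^+ #|[set z in R :\ x | ~~ inversion_values a x z]|
  = \sum_(k < #|R|) t ^+ k.
Proof.
move=> Ra.
pose pos (x : 'I_n) := (if a < x then x - a else x + n - a)%N.
rewrite -(@sum_exp_rank _ _ t pos R); last first.
  (* Entries above [a] have rank below n - a, the others at least n - a. *)
  move=> x y _ _; rewrite /pos => eq_pos; apply: val_inj => /=.
  case: a x y eq_pos {Ra pos} => [a lt_a] [x lt_x] [y lt_y] /=.
  by case: (ltnP a x); case: (ltnP a y); lia.
apply: eq_bigr => x Rx; congr (_ ^+ _); apply: eq_card => z; rewrite !inE.
case Rz: (z \in R); rewrite ?andbF //= andbT.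
have [-> | zx] /= := eqVneq z x; first by rewrite ltnn.
apply: inversion_valuesP => //; first by apply: contraNneq Ra => <-.
by apply: contraNneq Ra => <-.
Qed.

(** * Boxes, columns and arms of a partition shape *)

Section Columns.

Variables (n : nat) (la : n.-tuple nat).
Implicit Types u v : box la.

Lemma box_eq u v : row_of u = row_of v -> col_of u = col_of v -> u = v.
Proof.
case: u v => [r c] [r' c']; rewrite /row_of /col_of /= => rr'.
by subst r' => cc'; congr existT; apply: val_inj.
Qed.

Lemma col_le u : (col_of u <= tnth la (row_of u))%N.
Proof. by rewrite -ltnS ltn_ord. Qed.

(** Total in [c]: past the end of row [r], [inord] falls back to column 0. *)
Definition mkbox (r : 'I_n) (c : nat) : box la :=
  Tagged (fun r => 'I_(tnth la r).+1) (inord c : 'I_(tnth la r).+1).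

Lemma row_mkbox r c : row_of (mkbox r c) = r. Proof. by []. Qed.

Lemma col_mkbox r c : (c <= tnth la r)%N -> col_of (mkbox r c) = c.
Proof. by move=> le_c; rewrite /col_of /= inordK. Qed.

Lemma row_west u : row_of (west u) = row_of u. Proof. by []. Qed.

Lemma col_west u : col_of (west u) = (col_of u).-1.
Proof.
by apply: col_mkbox; apply: leq_trans (leq_pred _) (col_le u).
Qed.

Definition column (c : nat) : {set box la} := [set u | col_of u == c].

Lemma card_rows (P : pred 'I_n) (c : nat) :
  #|[set u : box la | (col_of u == c) && P (row_of u)]|
  = #|[set r | (c <= tnth la r)%N && P r]|.
Proof.
rewrite -(@card_in_imset _ _ (@row_of n la)); last first.
  move=> u v; rewrite !inE => /andP[/eqP cu _] /andP[/eqP cv _] /box_eq.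
  by apply; rewrite cu cv.
apply: eq_card => r; apply/imsetP/idP => [[u] | ]; rewrite !inE.
  by case/andP=> /eqP <- Pu ->; rewrite col_le Pu.
case/andP=> le_c Pr; exists (mkbox r c); rewrite ?row_mkbox // inE.
by rewrite col_mkbox // eqxx.
Qed.

Lemma card_column c : #|column c| = #|[set r | (c <= tnth la r)%N]|.
Proof.
transitivity #|[set u : box la | (col_of u == c) && predT (row_of u)]|.
  by apply: eq_card => u; rewrite !inE andbT.
by rewrite card_rows; apply: eq_card => r; rewrite !inE andbT.
Qed.

Definition above u : {set box la} := [set v | (col_of v == col_of u) && (row_of v < row_of u)%N].
Definition below u : {set box la} := [set v | (col_of v == col_of u) && (row_of u < row_of v)%N].

Lemma column_split u : column (col_of u) = above u :|: (u |: below u).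
Proof.
apply/setP=> v; rewrite !inE; have [cvu | ncvu] /= := eqVneq (col_of v) (col_of u).
  case: (ltngtP (row_of v) (row_of u)) => [||/val_inj rr]; rewrite ?orbT //.
  by rewrite (box_eq rr cvu) eqxx.
by rewrite orbF; apply/esym; apply: contraNF ncvu => /eqP->.
Qed.

Hypothesis la_partition : sorted geq la.

Lemma tnth_partition (r r' : 'I_n) : (r <= r')%N -> (tnth la r' <= tnth la r)%N.
Proof.
move=> le_rr'; rewrite !(tnth_nth 0%N).
have := sorted_leq_nth (fun a b c ba cb => leq_trans cb ba) leqnn 0%N la_partition.
by apply; rewrite ?inE ?size_tuple.
Qed.

(** Lower rows are never longer, so the length bound in the first term is automatic; upper rows are
    never shorter, so the second term is 0. *)
Lemma arm_partition u : arm u = #|below u|.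
Proof.
rewrite /arm (card_rows (fun r => (row_of u < r)%N)).
rewrite [X in (_ + X)%N](_ : _ = 0%N) ?addn0.
  apply: eq_card => r; rewrite !inE andbC -andbA; case: (ltnP (row_of u) r).
    by move/ltnW/tnth_partition => -> ; rewrite !andbT.
  by rewrite !andbF.
apply/eqP; rewrite cards_eq0 -subset0; apply/subsetP => r; rewrite !inE.
case/and3P => /ltnW /tnth_partition le_u lt_u _.
by move: le_u; rewrite leqNgt lt_u.
Qed.

Lemma typeA_partition u v : typeA u v = ~~ basement u && (v \in below u).
Proof.
rewrite /typeA inE; case: (ltnP (row_of u) (row_of v)); rewrite ?andbF //.
by move/ltnW/tnth_partition; rewrite /row_len => ->; rewrite !andbT.
Qed.

Lemma typeB_partition u v : typeB u v = false.
Proof.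
rewrite /typeB /row_len; apply/negP => /and4P[_ _ /ltnW /tnth_partition].
by rewrite leqNgt => /negP.
Qed.

Lemma coinv_sum (F : {ffun box la -> 'I_n}) :
  coinv F = (\sum_(u | ~~ basement u)
    #|[set v in below u | ~~ inversion_values (F (west u)) (F u) (F v)]|)%N.
Proof.
rewrite /coinv -sum1dep_card (eq_bigr (fun u =>
    \sum_(v in below u | ~~ inversion_values (F (west u)) (F u) (F v)) 1)%N).
  rewrite pair_big_dep; apply: eq_bigl => -[u v] /=.
  by rewrite typeA_partition typeB_partition orbF -andbA.
by move=> u _; rewrite sum1dep_card.
Qed.

(** * The weight at q = 1 as a product of local factors *)

Section LocalWeight.

Variables (K : fieldType) (t : K) (sigma : 'S_n) (S : nat -> {set 'I_n}).
Hypothesis t_generic : forall k : nat, (0 < k)%N -> t ^+ k != 1.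
Hypothesis card_S : forall c, (0 < c)%N -> #|S c| = #|column c|.
Implicit Types F G : {ffun box la -> 'I_n}.

Definition available u F : {set 'I_n} := S (col_of u) :\: F @: above u.

(* Vanishes on fillings that are attacking or have the wrong column sets, see
   [prod_local_weight_neq0]; using [#|available u F|] instead of [(arm u).+1],
   which agree otherwise, makes the sum over the entry of [u] always 1. *)
Definition local_weight u F : K :=
  if basement u then (F u == sigma (row_of u))%:R else
  if F u \notin available u F then 0 else
  if F (west u) \in available u F then (F u == F (west u))%:R else
  t ^+ #|[set z in available u F :\ F u | ~~ inversion_values (F (west u)) (F u) z]|
    * ((1 - t) / (1 - t ^+ #|available u F|)).

(** Lexicographic in (column, row), since row indices are below [n]. *)
Definition reading_key u : nat := (col_of u * n + row_of u)%N.

Lemma reading_key_west u : ~~ basement u -> (reading_key (west u) < reading_key u)%N.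
Proof.
rewrite /basement /reading_key row_west col_west; case: (col_of u) => //= c _.
by rewrite ltn_add2r mulSn; have := ltn_ord (row_of u); lia.
Qed.

Lemma eq_available u F G :
  (forall v, (reading_key v < reading_key u)%N -> F v = G v) ->
  available u F = available u G.
Proof.
move=> eqFG; congr (_ :\: _); apply: eq_in_imset => v; rewrite inE.
by case/andP=> /eqP cv rv; apply: eqFG; rewrite /reading_key cv ltn_add2l.
Qed.

Lemma local_weight_local u F G : F u = G u ->
  (forall v, (reading_key v < reading_key u)%N -> F v = G v) ->
  local_weight u F = local_weight u G.
Proof.
rewrite /local_weight => -> eqFG; rewrite (eq_available eqFG).
case: ifP => // /negbT bu.
by rewrite eqFG ?reading_key_west.
Qed.

(** The boxes above [u] omit [u], so they are too few to exhaust the prescribed entries of the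
    column. *)
Lemma available_neq0 u F : ~~ basement u -> (0 < #|available u F|)%N.
Proof.
rewrite /basement -lt0n => /card_S cardS.
rewrite cardsD subn_gt0 cardS.
apply: leq_ltn_trans (subset_leq_card (subsetIr _ _)) _.
apply: leq_ltn_trans (leq_imset_card _ _) _; apply: proper_card.
apply/properP; split; first by apply/subsetP=> v; rewrite !inE => /andP[].
by exists u; rewrite !inE ?eqxx // ltnn andbF.
Qed.

Lemma sum_local_weight u F : \sum_x local_weight u (upd F u x) = 1.
Proof.
case bu: (basement u); rewrite /local_weight bu.
  rewrite (bigD1 (sigma (row_of u))) //= ffunE !eqxx big1 ?addr0 // => x.
  by rewrite ffunE eqxx => /negbTE->.
have west_u : west u != u.
  by apply: contraFneq bu => wu; have := col_west u; rewrite wu /basement; lia.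
have avail x : available u (upd F u x) = available u F.
  by apply: eq_available => v; rewrite ffunE; case: eqP => // ->; rewrite ltnn.
set R := available u F; have R_gt0 : (0 < #|R|)%N by rewrite available_neq0 ?bu.
under eq_bigr => x _ do rewrite avail !ffunE eqxx (negbTE west_u) -/R.
case Ra: (F (west u) \in R).
  rewrite (bigD1 (F (west u))) //= Ra eqxx big1 ?addr0 // => x /negbTE ->.
  by rewrite if_same.
rewrite (bigID (mem R)) /= [X in _ + X]big1 ?addr0 => [|x ->] //.
under eq_bigr => x Rx do rewrite Rx /=.
rewrite -mulr_suml sum_coinv_entries ?Ra // mulrA.
have t1 k : (0 < k)%N -> 1 - t ^+ k != 0 by move=> k0; rewrite subr_eq0 eq_sym t_generic.
rewrite [X in X / _](_ : _ = 1 - t ^+ #|R|) ?divff ?t1 //.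
by rewrite -[RHS]opprB subrX1 mulrC -mulNr opprB.
Qed.

Lemma sum_prod_local_weight : \sum_F \prod_u local_weight u F = 1.
Proof.
(* Any starting filling will do; row indices supply entries in ['I_n]. *)
exact: sum_prod_local local_weight_local sum_local_weight [ffun u => row_of u].
Qed.

Definition has_columns F := forall c, (0 < c)%N -> F @: column c = S c.

(** The coefficient of [F] in [pbMacdonald] at q = 1. *)
Definition weight F : K :=
  t ^+ coinv F * \prod_(u | ~~ basement u && (F (west u) != F u))
     ((1 - t) / (1 - t ^+ (1 + arm u))).

Lemma NAF_column_inj F c : F \in NAF la sigma -> {in column c &, injective F}.
Proof.
rewrite inE => /andP[_ /'forall_forallP na] u v; rewrite !inE => /eqP cu /eqP cv.
move=> Fuv; apply/eqP; apply: contraNT (na u v) => uv.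
by rewrite /attacking Fuv uv cu cv !eqxx.
Qed.

Lemma NAF_west F u v : F \in NAF la sigma -> ~~ basement u ->
  v \in below u -> F (west u) != F v.
Proof.
rewrite inE => /andP[_ /'forall_forallP na] bu; rewrite inE => /andP[/eqP cv lt_uv].
apply: contraNneq (na (west u) v) => Fuv.
by rewrite /attacking Fuv eqxx col_west row_west cv prednK ?lt0n // eqxx lt_uv orbT.
Qed.

(** Entries in a column are distinct, so removing those above [u] leaves exactly those at [u] and
    below. *)
Lemma NAF_available F u : F \in NAF la sigma -> has_columns F -> ~~ basement u ->
  available u F = F @: (u |: below u).
Proof.
move=> nafF colF bu; rewrite /available -colF ?lt0n // column_split imsetU setDUl setDv set0U.
apply/setDidPl; rewrite disjoint_sym disjoints_subset; apply/subsetP=> _ /imsetP[v av ->].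
rewrite inE; apply/imsetP=> -[v' bv' Fv].
have cv : v \in column (col_of u) by rewrite column_split in_setU av.
have cv' : v' \in column (col_of u) by rewrite column_split in_setU bv' orbT.
have vv' := NAF_column_inj nafF cv cv' Fv.
move: av bv'; rewrite -vv' !inE => /andP[_ rv] /orP[/eqP vu | /andP[_ rv']].
  by rewrite vu ltnn in rv.
by move: rv; rewrite ltnNge (ltnW rv').
Qed.

Lemma prod_local_weight_NAF F : F \in NAF la sigma -> has_columns F ->
  \prod_u local_weight u F = weight F.
Proof.
move=> nafF colF; rewrite /weight coinv_sum -prodrXr big_mkcondr -big_split /=.
rewrite (bigID (@basement n la)) /= big1 ?mul1r => [|u bu]; last first.
  move: nafF; rewrite inE /local_weight bu => /andP[/forallP/(_ u)/implyP/(_ bu)/eqP-> _].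
  by rewrite eqxx.
apply: eq_bigr => u bu; rewrite /local_weight (negbTE bu) NAF_available //.
have subu : {subset u |: below u <= column (col_of u)}.
  by move=> v uv; rewrite column_split in_setU uv orbT.
have injF : {in u |: below u &, injective F}.
  by move=> v v' /subu cv /subu cv'; apply: (NAF_column_inj nafF cv cv').
have u_in : u \in u |: below u by rewrite setU11.
have nbu : u \notin below u by rewrite inE ltnn andbF.
have Fbelow : F @: (u |: below u) :\ F u = F @: below u.
  rewrite imsetU1; apply: setU1K; apply/imsetP => -[v bv /injF uv].
  by move: (bv); rewrite -(uv u_in (setU1r u bv)) (negbTE nbu).
(* The number of available entries becomes [1 + arm u], matching the denominator in [weight]. *)
rewrite imset_f //= Fbelow arm_partition card_in_imset // cardsU1 nbu.
have [FE | FN] /= := eqVneq (F (west u)) (F u).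
  rewrite FE imset_f // (eq_card0 (A := [set _ in _ | _])) ?mulr1 // => v.
  rewrite inE; case bv: (v \in below u) => //=.
  by rewrite inversion_values_diag // val_eqE eq_sym -FE NAF_west.
(* An available left entry other than [F u] would sit at a box below [u] and attack it. *)
case: ifP => [/imsetP[v] | _].
  rewrite in_setU1 => /orP[/eqP -> /eqP | bv /eqP]; first by rewrite (negbTE FN).
  by rewrite (negbTE (NAF_west nafF bu bv)).
congr (_ ^+ _ * _); rewrite -(@card_in_imset _ _ F); last first.
  move=> v v'; rewrite !inE => /andP[bv _] /andP[bv' _].
  by apply: injF; rewrite !inE ?bv ?bv' orbT.
apply: eq_card => z; rewrite !inE; apply/andP/imsetP => [[/imsetP[v bv ->] inv] | [v]].
  by exists v; rewrite // inE bv.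
by rewrite inE => /andP[bv inv] ->; split; rewrite ?imset_f.
Qed.

Lemma prod_local_weight_neq0 F : \prod_u local_weight u F != 0 ->
  F \in NAF la sigma /\ has_columns F.
Proof.
move/prodf_neq0 => wF.
have base u : basement u -> F u = sigma (row_of u).
  by move=> bu; have := wF u isT; rewrite /local_weight bu; case: (F u =P _) => // _; rewrite eqxx.
have avail u : ~~ basement u -> F u \in available u F.
  move=> bu; have := wF u isT; rewrite /local_weight (negbTE bu).
  by case: (F u \in _) => //=; rewrite eqxx.
have wavail u : ~~ basement u -> F (west u) \in available u F -> F u = F (west u).
  move=> bu Aw; have := wF u isT; rewrite /local_weight (negbTE bu) avail //= Aw.
  by case: (F u =P _) => //; rewrite eqxx.
have neF u v : col_of u = col_of v -> (row_of u < row_of v)%N -> F u != F v.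
  move=> cuv ruv; case bv: (basement v).
    have bu : basement u by rewrite /basement cuv.
    rewrite !base // (inj_eq perm_inj).
    by apply: contraTneq ruv => ->; rewrite ltnn.
  have := avail v (negbT bv); rewrite inE => /andP[nav _].
  by apply: contraNneq nav => <-; rewrite imset_f // inE cuv eqxx.
have injF c : {in column c &, injective F}.
  move=> u v; rewrite !inE => /eqP cu /eqP cv Fuv.
  have cuv : col_of u = col_of v by rewrite cu cv.
  apply: box_eq => //; apply: val_inj => /=.
  case: (ltngtP (row_of u) (row_of v)) => // [/neF | /neF].
    by rewrite Fuv eqxx => /(_ cuv).
  by rewrite Fuv eqxx => /(_ (esym cuv)).
have colF : has_columns F.
  (* By injectivity both sets have as many elements as the column, so one inclusion suffices. *)
  move=> c c_gt0; apply/eqP; rewrite eqEcard card_S // card_in_imset // leqnn andbT.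
  apply/subsetP=> x /imsetP[u]; rewrite inE => /eqP cu ->.
  have bu : ~~ basement u by rewrite /basement cu -lt0n.
  by have := avail u bu; rewrite inE cu => /andP[].
split=> //; rewrite inE; apply/andP; split.
  by apply/forallP=> u; apply/implyP=> /base ->.
apply/'forall_forallP => u v; rewrite /attacking; apply/negP.
case/andP=> /eqP Fuv /orP[/andP[uv /eqP cuv] | /andP[/eqP cv ruv]].
  by rewrite (injF (col_of u) u v) ?inE ?cuv ?eqxx in uv.
have le_la : (col_of v <= tnth la (row_of u))%N.
  exact: leq_trans (col_le v) (tnth_partition (ltnW ruv)).
(* The right neighbour of [u] exists because row lengths decrease. The entry [F u = F v] is still
   available there, hence forced, and clashes with [v] in the same column. *)
pose u' := mkbox (row_of u) (col_of v).
have cu' : col_of u' = col_of v by rewrite col_mkbox.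
have wu' : west u' = u by apply: box_eq => //; rewrite col_west cu' cv.
have bu' : ~~ basement u' by rewrite /basement cu' cv.
have Fv_avail : F (west u') \in available u' F.
  rewrite wu' Fuv inE -colF ?cu' ?cv // andbC imset_f ?inE ?cv //=.
  apply/imsetP=> -[x]; rewrite inE cu' => /andP[/eqP cx rx] Fvx.
  have := neF x v cx (ltn_trans rx ruv); by rewrite Fvx eqxx.
have := neF u' v cu' ruv; by rewrite wavail // wu' Fuv eqxx.
Qed.

End LocalWeight.

End Columns.

(** * Families of column sets *)

Section ColumnFamilies.

Variables (n : nat) (la : n.-tuple nat).
Let L := (\max_(r < n) tnth la r)%N.
Implicit Type S : {ffun 'I_L -> {set 'I_n}}.

(** Index j stands for column j + 1, and columns past [L] are empty. Column 0 repeats the value of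
    column 1, so later statements take positive [c]. *)
Definition column_family S (c : nat) : {set 'I_n} :=
  oapp S set0 (insub c.-1).

Lemma column_family_succ S (j : 'I_L) : column_family S j.+1 = S j.
Proof. by rewrite /column_family /= valK. Qed.

Lemma col_bound (u : box la) : (col_of u <= L)%N.
Proof. exact: leq_trans (col_le u) (leq_bigmax (row_of u)). Qed.

Lemma column_eq0 c : (L < c)%N -> column la c = set0.
Proof.
move=> lt_c; apply/setP=> u; rewrite !inE; apply: contraTF lt_c => /eqP <-.
by rewrite -leqNgt col_bound.
Qed.

Lemma column_family_out S c : (L < c)%N -> column_family S c = set0.
Proof. by case: c => // c lt_c; rewrite /column_family /= insubN // -leqNgt. Qed.

Lemma column_familyP (P : nat -> {set 'I_n} -> Prop) S :
  (forall c, (L < c)%N -> P c set0) -> (forall j : 'I_L, P j.+1 (S j)) ->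
  forall c, (0 < c)%N -> P c (column_family S c).
Proof.
move=> P_out P_in [//|c] _; case: (ltnP c L) => [lt_c | le_c].
  by have := P_in (Ordinal lt_c); rewrite -column_family_succ.
by rewrite column_family_out //; apply: P_out.
Qed.

Lemma prod_nonbasement (R : comNzRingType) (f : box la -> R) :
  \prod_(u | ~~ basement u) f u = \prod_(j < L) \prod_(u in column la j.+1) f u.
Proof.
rewrite [RHS](exchange_big_dep (fun u => ~~ basement u)) /=; last first.
  by move=> j u _; rewrite inE /basement => /eqP ->.
apply: eq_bigr => u bu; have c_gt0 : (0 < col_of u)%N by rewrite lt0n.
have lt_c : ((col_of u).-1 < L)%N by rewrite prednK // col_bound.
rewrite (big_pred1 (Ordinal lt_c)) // => j.
by rewrite inE /= -val_eqE /=; lia.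
Qed.

End ColumnFamilies.

(** * Evaluation at q = 1 *)

(** A double sum over column families and fillings is evaluated in both orders: fillings first gives
    the elementary symmetric product, families first gives the Macdonald polynomial. *)
Lemma pbMacdonald_q1 (K : fieldType) (t : K) (n : nat) (sigma : 'S_n)
    (la : n.-tuple nat) :
  (forall k : nat, (0 < k)%N -> t ^+ k != 1) -> sorted geq la ->
  pbMacdonald la sigma 1 t = elem_sym K n (conj_parts la).
Proof.
move=> t_generic la_partition.
pose fam := family (fun j : 'I_(\max_(r < n) tnth la r) =>
  [pred A : {set 'I_n} | #|A| == #|column la j.+1|]).
have card_fam S : S \in fam ->
    forall c, (0 < c)%N -> #|column_family S c| = #|column la c|.
  move/familyP=> famS; apply: (@column_familyP _ _ (fun c A => #|A| = #|column la c|)) => [c lt_c | j].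
    by rewrite column_eq0 ?cards0.
  by apply/eqP; have := famS j; rewrite inE.
(* Expanding the product selects one monomial, that is one entry set, per column. *)
have -> : elem_sym K n (conj_parts la) =
    \sum_(S in fam) \prod_j \prod_(i in S j) 'X_i.
  rewrite -(bigA_distr_big_dep _ (fun _ (A : {set 'I_n}) => \prod_(i in A) 'X_i)).
  rewrite /elem_sym /conj_parts big_map -[iota 1 _]/(iota (1 + 0) _) iotaDl big_map.
  rewrite -[X in iota 0 X]subn0 big_mkord; apply: eq_bigr => j _.
  by rewrite /mesym; apply: eq_bigl => A; rewrite inE card_column.
rewrite /pbMacdonald.
pose lw S (F : {ffun box la -> 'I_n}) :=
  \prod_u local_weight t sigma (@column_family n la S) u F.
transitivity (\sum_(S in fam) \sum_F lw S F *: \prod_j \prod_(i in S j) 'X_i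
              : {mpoly K[n]}); last first.
  apply: eq_bigr => S /card_fam cardS; rewrite -scaler_suml.
  by rewrite sum_prod_local_weight ?scale1r.
rewrite exchange_big /= [RHS](bigID (mem (NAF la sigma))) /=.
rewrite [X in _ = _ + X]big1 ?addr0 => [|F nafF]; last first.
  apply: big1 => S /card_fam cardS; case: (eqVneq (lw S F) 0) => [-> | /prod_local_weight_neq0].
    by rewrite scale0r.
  by case/(_ la_partition cardS)=> nafF'; rewrite nafF' in nafF.
apply: eq_bigr => F nafF.
(* Only the family of actual column sets of [F] gives it a nonzero local weight. *)
pose SF := [ffun j : 'I_(\max_(r < n) tnth la r) => F @: column la j.+1].
have famSF : SF \in fam.
  apply/familyP=> j; rewrite inE ffunE card_in_imset //.
  exact: NAF_column_inj nafF.
rewrite (bigD1 SF) //= [X in _ = _ + X]big1 ?addr0 => [|S /andP[/card_fam cardS neS]].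
  have colF : has_columns (column_family SF) F.
    apply: (@column_familyP _ _ (fun c A => F @: column la c = A)) => [c lt_c | j]; last first.
      by rewrite ffunE.
    by rewrite column_eq0 ?imset0.
  rewrite /lw prod_local_weight_NAF // /weight expr1n mul1r.
  congr (_ *: _).
    by congr (_ * _); apply: eq_bigr => u _; rewrite expr1n mul1r.
  rewrite prod_nonbasement; apply: eq_bigr => j _.
  by rewrite ffunE big_imset //=; apply: NAF_column_inj nafF.
case: (eqVneq (lw S F) 0) => [-> | /prod_local_weight_neq0]; first by rewrite scale0r.
case/(_ la_partition cardS)=> _ colF; case/eqP: neS; apply/ffunP=> j.
by rewrite ffunE -column_family_succ colF.
Qed.

Theorem theorem4p6 (K : fieldType) (t : K)
    (t_generic : forall k : nat, (0 < k)%N -> t ^+ k != 1)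
    (n : nat) (n_gt0 : (0 < n)%N) (sigma : 'S_n) (la : n.-tuple nat)
    (la_partition : sorted geq la) :
  pbMacdonald la sigma 1 t = pbMacdonald la sigma 1 0
  /\ pbMacdonald la sigma 1 0 = elem_sym K n (conj_parts la).
Proof.
(* The value 0 is itself generic, since its positive powers are 0. *)
have E0 : pbMacdonald la sigma 1 0 = elem_sym K n (conj_parts la).
  apply: pbMacdonald_q1 => // k k_gt0.
  by rewrite expr0n eqn0Ngt k_gt0 eq_sym oner_eq0.
by rewrite E0; split=> //; apply: pbMacdonald_q1.
Qed.
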